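(* Let $n\ge 1$ be an integer, let $G_1,G_2$ be compact (Hausdorff) groups, let $H_1$ be a closed subgroup of $G_1$ and $H_2$ a closed subgroup of $G_2$. If $(H_1,G_1)$ and $(H_2,G_2)$ are relatively $n$-isoclinic, then $d^{(n)}(H_1,G_1)=d^{(n)}(H_2,G_2)$.
   Context: Commutators: $[x,y]=x^{-1}y^{-1}xy$ and, for $m\ge 2$, $[x_1,\dots,x_{m+1}]=[[x_1,\dots,x_m],x_{m+1}]$ (left-normed). $Z_n(G)$ denotes the $n$-th term of the upper central series of $G$ ($Z_0(G)=1$, $Z_{i+1}(G)/Z_i(G)=Z(G/Z_i(G))$). For a subgroup $H\le G$, $[_nH,G]$ is the subgroup generated by all $[h_1,\dots,h_n,g]$ with $h_i\in H$, $g\in G$. For a compact group $G$, $\mu_G$ denotes its normalized Haar measure ($\mu_G(G)=1$), and $\mu_G^m$ the product measure on $G^m$. For a closed subgroup $H$ of a compact group $G$, set $D_{n+1}=\{(h_1,\dots,h_n,g)\in H^n\times G : [h_1,\dots,h_n,g]=1\}$ and define the relative $n$-th nilpotency degree $d^{(n)}(H,G)=(\mu_H^n\times\mu_G)(D_{n+1})$. Relative $n$-isoclinism: for groups $G_1,G_2$ and subgroups $H_i\le G_i$, $(H_1,G_1)$ and $(H_2,G_2)$ are relatively $n$-isoclinic if there is a pair $(\alpha,\beta)$ such that: (i) $\alpha: G_1/Z_n(G_1)\to G_2/Z_n(G_2)$ is an isomorphism whose restriction maps $H_1Z_n(G_1)/Z_n(G_1)$ (identified with $H_1/(Z_n(G_1)\cap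 H_1)$) isomorphically onto $H_2Z_n(G_2)/Z_n(G_2)$ (identified with $H_2/(Z_n(G_2)\cap H_2)$); (ii) $\beta:[_nH_1,G_1]\to[_nH_2,G_2]$ is an isomorphism; (iii) for all $h_1,\dots,h_n\in H_1$ and $g\in G_1$, $\beta([h_1,\dots,h_n,g])=[k_1,\dots,k_n,g']$ whenever $k_i\in H_2$ with $k_iZ_n(G_2)=\alpha(h_iZ_n(G_1))$ and $g'\in G_2$ with $g'Z_n(G_2)=\alpha(gZ_n(G_1))$; i.e. $\gamma(n,H_2,G_2)\circ\alpha^{n+1}=\beta\circ\gamma(n,H_1,G_1)$, where $\gamma(n,H,G)$ sends $(h_1(Z_n(G)\cap H),\dots,h_n(Z_n(G)\cap H),gZ_n(G))\mapsto[h_1,\dots,h_n,g]$ and $\alpha^{n+1}$ is the induced map on $(n+1)$-tuples. In the setting of compact groups the isomorphisms $\alpha,\beta$ are understood as isomorphisms of topological groups (quotients and subgroups carrying the induced topologies). *)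

(* Defs.v *)
From HB Require Import structures.
From mathcomp Require Import all_boot all_order all_algebra.
From mathcomp Require Import all_classical all_reals all_analysis.
Set Implicit Arguments. Unset Strict Implicit. Unset Printing Implicit Defensive.
Import Order.TTheory GRing.Theory Num.Theory.
Local Open Scope classical_set_scope.
Local Open Scope ring_scope.

Record group_ops (T : Type) := GroupOps {
  gmul : T -> T -> T; ginv : T -> T; gone : T }.

Section Groups.
Variables (T : Type) (o : group_ops T).
Local Notation "x * y" := (gmul o x y).
Local Notation "x ^-1" := (ginv o x).
Local Notation "1" := (gone o).

Definition is_group : Prop :=
  [/\ forall x y z, x * (y * z) = (x * y) * z,
      forall x, 1 * x = x, forall x, x * 1 = x,
      forall x, x^-1 * x = 1 & forall x, x * x^-1 = 1].

Definition is_subgroup (H : set T) : Prop :=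
  [/\ H 1, forall x y, H x -> H y -> H (x * y) & forall x, H x -> H (x^-1)].

Definition gen_subgroup (S : set T) : set T :=
  fun x => forall K, is_subgroup K -> S `<=` K -> K x.

Definition comm (x y : T) : T := x^-1 * y^-1 * x * y.

Definition commn (hs : seq T) (g : T) : T :=
  match hs with
  | [::] => g
  | h :: t => foldl comm h (rcons t g)
  end.

Fixpoint upper_central (i : nat) : set T :=
  match i with
  | 0%N => [set 1]
  | i'.+1 => [set x | forall y, upper_central i' (comm x y)]
  end.

Fixpoint all_in (H : set T) (s : seq T) : Prop :=
  match s with [::] => True | x :: s' => H x /\ all_in H s' end.

Definition commH (n : nat) (H : set T) : set T :=
  gen_subgroup [set c | exists hs g, [/\ size hs = n, all_in H hs & c = commn hs g]].

Definition cong_mod (N : set T) (x y : T) : Prop := N (x^-1 * y).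

Definition saturated (N : set T) (V : set T) : Prop :=
  forall x y, cong_mod N x y -> V x -> V y.

End Groups.

Definition compact_group (T : ptopologicalType) (o : group_ops T) : Prop :=
  [/\ is_group o, hausdorff_space T, compact [set: T],
      continuous (fun p : T * T => gmul o p.1 p.2) & continuous (ginv o)].

Definition borelT (T : ptopologicalType) := g_sigma_algebraType (@open T).

Section Haar.
Variables (R : realType) (T : ptopologicalType) (o : group_ops T).
Local Open Scope ereal_scope.

Definition radon (mu : {measure set (borelT T) -> \bar R}) : Prop :=
  (forall B : set (borelT T), measurable B ->
     mu B = ereal_inf [set mu U | U in [set U : set T | open U /\ B `<=` U]]) /\
  (forall U : set T, open U ->
     mu U = ereal_sup [set mu K | K in [set K : set T | compact K /\ K `<=` U]]).

(* normalized Haar measure of the closed subgroup H, viewed as a Borel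
   measure on the ambient group concentrated on H *)
Definition haar_on (H : set T) (mu : {measure set (borelT T) -> \bar R}) : Prop :=
  [/\ radon mu, mu [set: borelT T] = 1, mu (~` H) = 0 &
      forall (x : T) (B : set (borelT T)), H x -> measurable B ->
        mu [set gmul o x b | b in B] = mu B].

Fixpoint iint (H : set T) (muH : {measure set (borelT T) -> \bar R}) (k : nat)
    (F : seq T -> \bar R) : \bar R :=
  match k with
  | 0%N => F [::]
  | k'.+1 => \int[muH]_(h in H) iint H muH k' (fun s => F (h :: s))
  end.

(* d^(n)(H,G) = (mu_H^n x mu_G)(D_{n+1}), computed as an iterated integral *)
Definition rel_nilp_degree (n : nat) (H : set T)
    (muH muG : {measure set (borelT T) -> \bar R}) : \bar R :=
  iint H muH n (fun hs => muG [set g : borelT T | commn o hs g = gone o]).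

End Haar.

(* alpha : G1/Z_n(G1) -> G2/Z_n(G2) is represented by a lift alpha : G1 -> G2
   (alpha(x Z1) = alpha x Z2); the quotient topology on G/Z is the one whose
   open sets are the images of the open Z-saturated subsets of G.
   beta : [_nH1,G1] -> [_nH2,G2] is represented by beta : G1 -> G2 with
   inverse beta' : G2 -> G1 on these subgroups (subspace topologies). *)
Definition rel_n_isoclinic (n : nat) (T1 T2 : ptopologicalType)
    (o1 : group_ops T1) (H1 : set T1) (o2 : group_ops T2) (H2 : set T2) : Prop :=
  let Z1 := upper_central o1 n in
  let Z2 := upper_central o2 n in
  let C1 := commH o1 n H1 in
  let C2 := commH o2 n H2 in
  exists (alpha : T1 -> T2) (beta : T1 -> T2) (beta' : T2 -> T1),
  [/\
    (* (i) alpha is a well defined bijective homomorphism G1/Z1 -> G2/Z2 *)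
    [/\ forall x y, cong_mod o1 Z1 x y <-> cong_mod o2 Z2 (alpha x) (alpha y),
        forall y, exists x, cong_mod o2 Z2 (alpha x) y &
        forall x y, cong_mod o2 Z2 (alpha (gmul o1 x y))
                                   (gmul o2 (alpha x) (alpha y))],
    (* ... mapping H1Z1/Z1 onto H2Z2/Z2 *)
    (forall h, H1 h -> exists2 k, H2 k & cong_mod o2 Z2 (alpha h) k) /\
    (forall k, H2 k -> exists2 h, H1 h & cong_mod o2 Z2 (alpha h) k),
    (* ... which is a homeomorphism for the quotient topologies *)
    (forall V : set T2, open V -> saturated o2 Z2 V -> open (alpha @^-1` V)) /\
    (forall U : set T1, open U -> saturated o1 Z1 U ->
       open [set y | exists2 x, U x & cong_mod o2 Z2 (alpha x) y]),
    [/\ forall x, C1 x -> C2 (beta x),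
        forall y, C2 y -> C1 (beta' y),
        forall x, C1 x -> beta' (beta x) = x,
        forall y, C2 y -> beta (beta' y) = y &
        forall x y, C1 x -> C1 y -> beta (gmul o1 x y) = gmul o2 (beta x) (beta y)] /\
    ({within C1, continuous beta} /\ {within C2, continuous beta'}) &
    forall (hs : seq T1) (g : T1) (ks : seq T2) (g' : T2),
      size hs = n -> size ks = n -> all_in H1 hs -> all_in H2 ks ->
      (forall i, (i < n)%N ->
         cong_mod o2 Z2 (alpha (nth (gone o1) hs i)) (nth (gone o2) ks i)) ->
      cong_mod o2 Z2 (alpha g) g' ->
      beta (commn o1 hs g) = commn o2 ks g'].

(* Main.v *)
Require Import Defs.
From mathcomp Require Import all_boot all_order all_algebra finmap.
From mathcomp Require Import all_classical all_reals all_analysis.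
From mathcomp Require Import measurable_realfun lra zify.
Set Implicit Arguments. Unset Strict Implicit.
Unset Printing Implicit Defensive.
Import Order.TTheory GRing.Theory Num.Theory.
Import HBNNSimple.
Local Open Scope classical_set_scope.
Local Open Scope ring_scope.

(** The isomorphism [alpha] of [G1/Z_n(G1)] and [G2/Z_n(G2)] is handled as the
    correspondence [rho x y] := "[alpha] maps the class of [x] to that of [y]"
    between [G1] and [G2]: it is compatible with the group laws, total on both
    sides (also between [H1] and [H2]), and maps closed sets to closed sets in
    both directions.

    The uniqueness proof for Haar measure works along such a correspondence. Let
    [A] be closed and [U] an open neighbourhood of [rho A]. Suitable finitely
    many translates of [A], weighted by [mu2], average to a function bounded on
    [H1] by [mu2 U^-1], while its integral is [mu1 A]. By outer regularity
    [mu1 A <= mu2 (rho A)^-1]; the case [rho = eq] says that inversion does not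
    decrease [mu2], hence [mu1 A <= mu2 (rho A)]. With inner regularity, the
    lower integrals of [rho]-related functions agree, whether the functions are
    measurable or not, so the iterated integrals can be compared one variable at
    a time. Finally [beta] shows that the sets [{g | [h_1,...,h_n,g] = 1}] of
    the two groups are [rho]-related. *)

Definition rel_image {T1 T2 : Type} (rho : T1 -> T2 -> Prop) (A : set T1) :
    set T2 := [set y | exists2 x, A x & rho x y].

Definition rel_preimage {T1 T2 : Type} (rho : T1 -> T2 -> Prop) (B : set T2) :
    set T1 := [set x | exists2 y, B y & rho x y].

Lemma rel_image_eq (T : Type) (A : set T) : rel_image eq A = A.
Proof. by apply/seteqP; split=> [_ [x Ax <-]|x Ax] //; exists x. Qed.

Lemma rel_preimage_eq (T : Type) (A : set T) : rel_preimage eq A = A.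
Proof. by apply/seteqP; split=> [_ [x Ax ->]|x Ax] //; exists x. Qed.

(** * Groups and the upper central series *)

Definition normal_subgroup {T : Type} (o : group_ops T) (N : set T) : Prop :=
  is_subgroup o N /\
  forall x y, N x -> N (gmul o (gmul o (ginv o y) x) y).

Section GroupTheory.
Context {T : Type} {o : group_ops T}.
Hypothesis grp : is_group o.
Local Notation "x * y" := (gmul o x y).
Local Notation "x ^-1" := (ginv o x).
Local Notation "1" := (gone o).

Lemma gmulA x y z : x * y * z = x * (y * z).
Proof. by case: grp => ->. Qed.

Lemma gmul1g x : 1 * x = x.
Proof. by case: grp. Qed.

Lemma gmulg1 x : x * 1 = x.
Proof. by case: grp. Qed.

Lemma gmulVg x : x^-1 * x = 1.
Proof. by case: grp. Qed.

Lemma gmulgV x : x * x^-1 = 1.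
Proof. by case: grp. Qed.

Lemma gmulKg x y : x^-1 * (x * y) = y.
Proof. by rewrite -gmulA gmulVg gmul1g. Qed.

Lemma gmulVKg x y : x * (x^-1 * y) = y.
Proof. by rewrite -gmulA gmulgV gmul1g. Qed.

Lemma gmulg1_eq x y : x * y = 1 -> y = x^-1.
Proof. by move=> xy1; rewrite -(gmulKg x y) xy1 gmulg1. Qed.

Lemma ginvK x : x^-1^-1 = x.
Proof. by apply/esym/gmulg1_eq; rewrite gmulVg. Qed.

Lemma ginvM x y : (x * y)^-1 = y^-1 * x^-1.
Proof. by apply/esym/gmulg1_eq; rewrite gmulA gmulVKg gmulgV. Qed.

Lemma ginv1 : 1^-1 = 1.
Proof. by apply/esym/gmulg1_eq; rewrite gmul1g. Qed.

Definition gsimp := (gmulA, gmul1g, gmulg1, gmulVg, gmulgV, gmulKg, gmulVKg,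
  ginvM, ginvK, ginv1).

Lemma preimage_ginvK (A : set T) : ginv o @^-1` (ginv o @^-1` A) = A.
Proof. by apply/seteqP; split=> x /=; rewrite ginvK. Qed.

Lemma image_gmul x (A : set T) : gmul o x @` A = gmul o x^-1 @^-1` A.
Proof.
apply/seteqP; split=> [_ [a Aa <-]|y Ay] /=; first by rewrite gmulKg.
by exists (x^-1 * y) => //; rewrite gmulVKg.
Qed.

Lemma upper_central_normal n : normal_subgroup o (upper_central o n).
Proof.
elim: n => [|n [[Z1 ZM ZV] ZJ]] /=.
  split=> [|x y ->]; last by rewrite /= !gsimp.
  by split=> [//|x y -> ->|x ->] /=; rewrite !gsimp.
split=> [|x g Zx y] /=.
  split=> [y|x x' Zx Zx' y|x Zx y].
  - by rewrite /comm !gsimp.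
  - have -> : comm o (x * x') y = x'^-1 * comm o x y * x' * comm o x' y.
      by rewrite /comm !gsimp.
    exact/ZM/Zx'/ZJ/Zx.
  - have -> : comm o x^-1 y = x^-1^-1 * (comm o x y)^-1 * x^-1.
      by rewrite /comm !gsimp.
    exact/ZJ/ZV/Zx.
have -> : comm o (g^-1 * x * g) y = g^-1 * comm o x (g * y * g^-1) * g.
  by rewrite /comm !gsimp.
exact/ZJ/Zx.
Qed.

Section Congruence.
Context {N : set T}.
Hypothesis nN : normal_subgroup o N.

Lemma cong_mod_refl x : cong_mod o N x x.
Proof. by rewrite /cong_mod gmulVg; case: nN => -[]. Qed.

Lemma cong_mod_sym x y : cong_mod o N x y -> cong_mod o N y x.
Proof. by rewrite /cong_mod; case: nN => -[_ _ NV] _ /NV; rewrite !gsimp. Qed.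

Lemma cong_mod_trans y x z :
  cong_mod o N x y -> cong_mod o N y z -> cong_mod o N x z.
Proof.
rewrite /cong_mod; case: nN => -[_ NM _] _ xy yz.
by have := NM _ _ xy yz; rewrite !gsimp.
Qed.

Lemma cong_modM x x' y y' : cong_mod o N x y -> cong_mod o N x' y' ->
  cong_mod o N (x * x') (y * y').
Proof.
rewrite /cong_mod; case: nN => -[_ NM _] NJ xy xy'.
by have := NM _ _ (NJ _ x' xy) xy'; rewrite !gsimp.
Qed.

Lemma cong_modV x y : cong_mod o N x y -> cong_mod o N x^-1 y^-1.
Proof.
rewrite /cong_mod; case: nN => -[_ _ NV] NJ /NV/(NJ _ x^-1).
by rewrite !gsimp.
Qed.

Lemma saturatedC_cong_mod (A : set T) :
  saturated o N (~` rel_image (cong_mod o N) A).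
Proof.
move=> x y xy nAx [a Aa ay]; apply: nAx; exists a => //.
exact/(cong_mod_trans ay)/cong_mod_sym.
Qed.

End Congruence.
End GroupTheory.

Lemma cancel_morph_eq1 (T1 T2 : Type) (o1 : group_ops T1) (o2 : group_ops T2)
    (C : set T1) (beta : T1 -> T2) (beta' : T2 -> T1) :
  is_group o1 -> is_group o2 -> C (gone o1) ->
  (forall x, C x -> beta' (beta x) = x) ->
  (forall x y, C x -> C y -> beta (gmul o1 x y) = gmul o2 (beta x) (beta y)) ->
  forall c, C c -> beta c = gone o2 <-> c = gone o1.
Proof.
move=> grp1 grp2 C1 betaK betaM c Cc.
have beta1 : beta (gone o1) = gone o2.
  have := betaM _ _ C1 C1; rewrite (gmulg1 grp1) => b1.
  by rewrite -(gmulKg grp2 (beta (gone o1)) (beta (gone o1))) -b1 (gmulVg grp2).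
by split=> [c1|->//]; rewrite -(betaK _ C1) beta1 -c1 betaK.
Qed.

(** * Compact groups and the Borel sigma-algebra *)

Section CompactGroup.
Context {T : ptopologicalType} {o : group_ops T}.
Hypothesis cgG : compact_group o.
Let grp : is_group o. Proof. by case: cgG. Qed.

Lemma continuous_gmul {X : topologicalType} (f g : X -> T) :
  continuous f -> continuous g -> continuous (fun x => gmul o (f x) (g x)).
Proof.
move=> cf cg x; case: cgG => _ _ _ cM _.
apply: (@continuous_comp _ _ _ (fun x => (f x, g x))
  (fun p : T * T => gmul o p.1 p.2)); last exact: cM.
by apply: cvg_pair; [exact: cf|exact: cg].
Qed.

Lemma continuous_ginv {X : topologicalType} (f : X -> T) :
  continuous f -> continuous (fun x => ginv o (f x)).
Proof.
move=> cf x; case: cgG => _ _ _ _ cV.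
by apply: (@continuous_comp _ _ _ f (ginv o)); [exact: cf|exact: cV].
Qed.

Lemma continuous_comm {X : topologicalType} (f g : X -> T) :
  continuous f -> continuous g -> continuous (fun x => comm o (f x) (g x)).
Proof.
by move=> cf cg; rewrite /comm; do !apply: continuous_gmul => //;
  apply: continuous_ginv.
Qed.

Lemma closed_preimage_gmul x (A : set T) :
  closed A -> closed (gmul o x @^-1` A).
Proof.
move: A; apply/continuous_closedP.
by apply: (@continuous_gmul _ (cst x) id) => y; [exact: cvg_cst|exact: cvg_id].
Qed.

Lemma open_preimage_ginv (U : set T) : open U -> open (ginv o @^-1` U).
Proof. by move: U; apply/continuousP; case: cgG. Qed.

Lemma closed_preimage_ginv (A : set T) : closed A -> closed (ginv o @^-1` A).
Proof. by move: A; apply/continuous_closedP; case: cgG. Qed.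

Lemma compact_group_closed (A : set T) : compact A -> closed A.
Proof. by case: cgG => _ hT _ _ _; exact: compact_closed. Qed.

Lemma closed_group_compact (A : set T) : closed A -> compact A.
Proof. by case: cgG => _ _ cT _ _ clA; apply: subclosed_compact clA cT _. Qed.

Lemma closed_gone : closed [set gone o].
Proof. by apply: compact_group_closed; exact: compact_set1. Qed.

Lemma closed_upper_central n : closed (upper_central o n).
Proof.
elim: n => [|n IHn] /=; first exact: closed_gone.
have -> : [set x | forall y, upper_central o n (comm o x y)] =
    \bigcap_y ((comm o ^~ y) @^-1` upper_central o n).
  by apply/seteqP; split=> x Zx y; [move=> _|]; exact: Zx.
apply: closed_bigI => y _; apply: (continuous_closedP _).1 IHn.
by apply: (@continuous_comm _ id (cst y)) => x; [exact: cvg_id|exact: cvg_cst].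
Qed.

Lemma closed_commn_eq1 (hs : seq T) : closed [set g | commn o hs g = gone o].
Proof.
case: hs => [|h t]; rewrite /commn; first exact: closed_gone.
have -> : [set g | foldl (comm o) h (rcons t g) = gone o] =
    comm o (foldl (comm o) h t) @^-1` [set gone o].
  by apply/seteqP; split=> g /=; rewrite foldl_rcons.
apply: (continuous_closedP _).1 closed_gone.
by apply: (@continuous_comm _ (cst _) id) => x; [exact: cvg_cst|exact: cvg_id].
Qed.

Lemma closed_cong_mod (N A : set T) :
  closed N -> closed A -> closed (rel_image (cong_mod o N) A).
Proof.
move=> clN clA; apply: compact_group_closed.
have -> : rel_image (cong_mod o N) A = [set gmul o p.1 p.2 | p in A `*` N].
  apply/seteqP; split=> [x [a Aa Nax]|_ [[a z] [/= Aa Nz] <-]].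
    by exists (a, gmul o (ginv o a) x) => //=; rewrite !(gsimp grp).
  by exists a => //; rewrite /cong_mod !(gsimp grp).
apply: continuous_compact.
  by apply: continuous_subspaceT; case: cgG.
by apply: compact_setX; exact: closed_group_compact.
Qed.

Lemma near_translate_subset (S U : set T) (y0 : T) :
    closed S -> open U -> S `<=` U ->
  \forall y \near y0,
    gmul o (ginv o y0) @^-1` S `<=` gmul o (ginv o y) @^-1` U.
Proof.
move=> clS oU SU.
pose P y s := U (gmul o (ginv o y) (gmul o y0 s)).
have : \forall y \near y0, S `<=` P y.
  apply: ((compact_near_coveringP S).1 (closed_group_compact clS)) => s Ss.
  have cf : continuous (fun p : T * T => gmul o (ginv o p.2) (gmul o y0 p.1)).
    apply: continuous_gmul.
      by apply: continuous_ginv => p; exact: cvg_snd.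
    by apply: continuous_gmul => p; [exact: cvg_cst|exact: cvg_fst].
  apply: (cf (s, y0)); apply: open_nbhs_nbhs; split => //=.
  by rewrite (gmulKg grp); exact: SU.
by apply: filterS => y SP x /SP; rewrite /P (gmulVKg grp).
Qed.

End CompactGroup.

Section Borel.
Context {T : ptopologicalType}.

Lemma open_borel (A : set (borelT T)) : @open T A -> measurable A.
Proof. by move=> oA; exact: sub_sigma_algebra. Qed.

Lemma closed_borel (A : set (borelT T)) : @closed T A -> measurable A.
Proof.
move=> clA; rewrite -[A]setCK; apply: measurableC; apply: open_borel.
exact: closed_openC.
Qed.

End Borel.

(** * Integrals of non-negative functions *)

Lemma sum_nat_ltn (N m : nat) : (\sum_(i < N) (i < m) = minn N m)%N.
Proof.
elim: N => [|N IHN]; first by rewrite big_ord0 min0n.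
by rewrite big_ord_recr /= IHN; lia.
Qed.

Lemma count_levels (R : archiRealFieldType) (d t : R) (N : nat) : 0 < d ->
  (\sum_(i < N) (i.+1%:R * d <= t)%R = minn N (Num.truncn (t / d)))%N.
Proof.
move=> d0; rewrite -sum_nat_ltn; apply: eq_bigr => i _.
by rewrite truncn_gt_nat ler_pdivlMr.
Qed.

Section Integral.
Context d (X : measurableType d) {R : realType}.
Context (mu : {measure set X -> \bar R}).
Local Open Scope ereal_scope.

(* The integral of a non-negative function is a supremum over simple functions,
   so monotonicity needs no measurability. *)
Lemma ge0_le_integral_nonmeas (D : set X) (f g : X -> \bar R) :
  (forall x, D x -> 0 <= f x) -> (forall x, D x -> f x <= g x) ->
  \int[mu]_(x in D) f x <= \int[mu]_(x in D) g x.
Proof.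
move=> f0 fg; have g0 x : D x -> 0 <= g x.
  by move=> Dx; exact: le_trans (f0 _ Dx) (fg _ Dx).
rewrite !ge0_integralE//; apply: ereal_sup_le => _ [h hf <-]; exists h => // x.
apply: le_trans (hf x) _; rewrite /patch; case: ifPn => // /set_mem; exact: fg.
Qed.

Lemma integral_sum_indic N (D : set X) (w : nat -> \bar R) (B : nat -> set X) :
  measurable D -> (forall i, 0 <= w i) -> (forall i, measurable (B i)) ->
  \int[mu]_(x in D) (\sum_(i < N) w i * (\1_(B i) x)%:E) =
  \sum_(i < N) w i * mu (B i `&` D).
Proof.
move=> mD w0 mB.
have mI i : measurable_fun D (fun x => (\1_(B i) x)%:E : \bar R).
  by apply/measurable_EFinP; exact: measurable_indic.
rewrite ge0_integral_sum//.
- by apply: eq_bigr => i _; rewrite ge0_integralZl ?integral_indic.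
- by move=> i; exact: measurable_funeM.
- by move=> i x _; apply: mule_ge0 => //; rewrite lee_fin.
Qed.

Lemma sum_levels_le_integral N (D : set X) (e : R) (f : X -> \bar R)
    (B : nat -> set X) :
  measurable D -> (0 < e)%R -> (forall x, D x -> 0 <= f x) ->
  (forall i, measurable (B i)) ->
  (forall i x, B i x -> D x -> (i.+1%:R * e)%:E <= f x) ->
  \sum_(i < N) e%:E * mu (B i `&` D) <= \int[mu]_(x in D) f x.
Proof.
move=> mD e0 f0 mB Bf; have e_ge0 : 0 <= e%:E by rewrite lee_fin ltW.
rewrite -(integral_sum_indic N mD (fun=> e_ge0) mB).
apply: ge0_le_integral_nonmeas => x Dx.
  by apply: sume_ge0 => i _; rewrite -EFinM lee_fin mulr_ge0// ltW.
have := f0 x Dx; case fx : (f x) => [t| |] // t0; last by rewrite leey.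
rewrite lee_fin in t0; rewrite sumEFin lee_fin -mulr_sumr.
apply: (@le_trans _ _ (e * (Num.truncn (t / e))%:R)%R); last first.
  by rewrite mulrC -ler_pdivlMr// truncn_le divr_ge0// ltW.
rewrite ler_pM2l//; apply: (@le_trans _ _ (minn N (Num.truncn (t / e)))%:R%R).
  rewrite -count_levels// natr_sum; apply: ler_sum => i _.
  rewrite indicE ler_nat; case: (boolP (x \in B i)) => // /set_mem Bx.
  by have := Bf i x Bx Dx; rewrite fx lee_fin => ->.
by rewrite ler_nat geq_minr.
Qed.

Lemma integral_le_sum_levels N (D : set X) (e : R) (f : X -> R) :
  measurable D -> measurable_fun setT f -> (0 < e)%R ->
  (forall x, D x -> 0 <= f x <= N%:R * e)%R ->
  \int[mu]_(x in D) (f x)%:E <= e%:E * mu D +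
    \sum_(i < N) e%:E * mu ([set x | i.+1%:R * e <= f x]%R `&` D).
Proof.
move=> mD mf e0 f0N.
pose B (i : nat) := [set x | i%:R * e <= f x]%R.
have mB i : measurable (B i).
  by rewrite -[B i]setTI; apply: measurable_fun_le.
have B0 : mu D = mu (B 0%N `&` D).
  congr (mu _); apply/esym/setIidr => x Dx.
  by rewrite /B /= mul0r; case/andP: (f0N x Dx).
have e_ge0 : 0 <= e%:E by rewrite lee_fin ltW.
rewrite B0 (_ : _ + _ = \sum_(i < N.+1) e%:E * mu (B i `&` D)); last first.
  by rewrite big_ord_recl.
rewrite -(integral_sum_indic N.+1 mD (fun=> e_ge0) mB).
apply: ge0_le_integral_nonmeas => x Dx; have /andP[f0 fN] := f0N x Dx.
  by rewrite lee_fin.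
rewrite sumEFin lee_fin -mulr_sumr mulrC -ler_pdivrMr// big_ord_recl /=.
rewrite indicE mem_set; last by rewrite /B /= mul0r.
rewrite (le_trans (ltW (truncnS_gt _)))// -natr1 addrC lerD2l.
have tN : (Num.truncn (f x / e) <= N)%N.
  by rewrite -[leqRHS](@natrK R) le_truncn// ler_pdivrMr.
rewrite -(minn_idPr tN) -count_levels// natr_sum ler_sum// => i _.
rewrite indicE ler_nat; case: (boolP (_ <= _)%R) => // Bx.
by rewrite mem_set.
Qed.

End Integral.

Lemma iint_ge0_le1 (R : realType) (T : ptopologicalType) (H : set T)
    (mu : {measure set (borelT T) -> \bar R}) k F :
  measurable (H : set (borelT T)) -> (mu H <= 1)%E ->
  (forall s, 0 <= F s <= 1)%E -> (0 <= iint H mu k F <= 1)%E.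
Proof.
move=> mH muH1; elim: k F => [|k IHk] F F01 /=; first exact: F01.
have /all_and2[I0 I1] h : (0 <= iint H mu k (fun s => F (h :: s)))%E /\
    (iint H mu k (fun s => F (h :: s)) <= 1)%E.
  by apply/andP/IHk.
rewrite integral_ge0//=; apply: le_trans muH1.
by rewrite -[leRHS]mul1e -integral_cst//; exact: ge0_le_integral_nonmeas.
Qed.

(** * Haar measures *)

Record haar_subgroup {R : realType} {T : ptopologicalType} (o : group_ops T)
    (H : set T) (mu : {measure set (borelT T) -> \bar R}) :
    Prop := HaarSubgroup {
  haar_compact_group : compact_group o;
  haar_is_subgroup : is_subgroup o H;
  haar_closed : closed H;
  haar_measure : haar_on o H mu }.

Section Haar.
Context {R : realType} {T : ptopologicalType} {o : group_ops T}.
Context {H : set T} {mu : {measure set (borelT T) -> \bar R}}.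
Hypothesis haarH : haar_subgroup o H mu.
Let cgG := haar_compact_group haarH.
Let grp : is_group o. Proof. by case: cgG. Qed.
Local Open Scope ereal_scope.

Lemma haar_le1 (B : set (borelT T)) : measurable B -> mu B <= 1.
Proof.
by case: haarH => _ _ _ [_ <- _ _] mB; apply: le_measure; rewrite ?inE.
Qed.

Lemma haar_fin_num (B : set (borelT T)) : measurable B -> mu B \is a fin_num.
Proof.
move=> mB; rewrite ge0_fin_numE//; apply: le_lt_trans (haar_le1 mB) _.
exact: ltry.
Qed.

Lemma haar_setC (B : set (borelT T)) : measurable B -> mu (~` B) = 1 - mu B.
Proof.
move=> mB; case: haarH => _ _ _ [_ <- _ _]; rewrite -setTD measureD// ?setTI//.
by rewrite -ge0_fin_numE// haar_fin_num.
Qed.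

Lemma measurable_haar_subgroup : measurable (H : set (borelT T)).
Proof. exact: closed_borel (haar_closed haarH). Qed.

Lemma haar_setI (B : set (borelT T)) : measurable B -> mu (B `&` H) = mu B.
Proof.
move=> mB; rewrite [RHS](measureDI mu mB measurable_haar_subgroup).
rewrite [X in X + _](_ : _ = 0) ?add0e//.
case: haarH => _ _ _ [_ _ muHC _].
have mH := measurable_haar_subgroup.
by apply: subset_measure0 muHC; [exact: measurableD|exact: measurableC|
  exact: subDsetr].
Qed.

Lemma haar_supp (B : set (borelT T)) : measurable B -> H `<=` B -> mu B = 1.
Proof.
move=> mB HB; case: (haarH) => _ _ _ [_ <- _ _].
by rewrite -haar_setI// -[RHS]haar_setI// setTI setIidr.
Qed.

Lemma haar_outer (B : set (borelT T)) (e : R) : measurable B -> (0 < e)%R ->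
  exists U : set T, [/\ open U, B `<=` U & mu U < mu B + e%:E].
Proof.
move=> mB e0; case: haarH => _ _ _ [[outer _] _ _ _].
have := haar_fin_num mB; rewrite outer// => Bfin.
by have [_ [U [oU BU] <-] muU] := lb_ereal_inf_adherent e0 Bfin; exists U.
Qed.

Lemma haar_inner (B : set (borelT T)) (e : R) : measurable B -> (0 < e)%R ->
  exists K : set T, [/\ closed K, K `<=` B & mu B <= mu K + e%:E].
Proof.
move=> mB e0; have mBC := measurableC mB.
have [U [oU BU muU]] := haar_outer mBC e0.
have mU : measurable (U : set (borelT T)) by exact: open_borel.
exists (~` U); split; first exact: open_closedC.
  by rewrite -[B]setCK; exact: subsetC.
move: muU; rewrite !haar_setC//.
move: (haar_fin_num mU) (haar_fin_num mB) => /fineK <- /fineK <-.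
by rewrite -!EFinB -!EFinD lte_fin lee_fin => ?; lra.
Qed.

Lemma haar_preimage_gmulV x (B : set (borelT T)) : H x -> measurable B ->
  mu (gmul o (ginv o x) @^-1` B) = mu B.
Proof.
move=> Hx mB; case: haarH => _ _ _ [_ _ _ /(_ _ _ Hx mB) <-].
by rewrite (image_gmul grp).
Qed.

Lemma haar_preimage_ginv_translate x (U : set T) : H x -> open U ->
  mu ((fun y => gmul o (ginv o y) x) @^-1` U) = mu (ginv o @^-1` U).
Proof.
move=> Hx oU; rewrite -[RHS](haar_preimage_gmulV Hx); last first.
  by apply: open_borel; exact: (open_preimage_ginv cgG).
by congr (mu _); apply/seteqP; split=> y; rewrite /= !(gsimp grp).
Qed.

(* The disjoint pieces [E i] turn an average over the group into a finite convex
   combination. *)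
Lemma haar_partition (W : T -> set T) :
  (forall y, H y -> open (W y)) -> (forall y, H y -> W y y) ->
  exists N (y : nat -> T) (E : nat -> set (borelT T)),
    [/\ forall i, H (y i), forall i, measurable (E i), trivIset setT E,
        forall i, E i `<=` W (y i) & \sum_(i < N) mu (E i) = 1].
Proof.
move=> oW Wy.
have := closed_group_compact cgG (haar_closed haarH).
rewrite compact_cover => /(_ _ H W oW)[y Hy|D DH HD].
  by exists y => //; exact: Wy.
pose y i := nth (gone o) (enum_fset D) i.
have Hy i : H (y i).
  have [iD|Di] := ltnP i (size (enum_fset D)).
    by have := DH (y i); rewrite inE; apply; exact: mem_nth.
  by rewrite /y nth_default//; case: (haar_is_subgroup haarH).
pose F i : set (borelT T) := W (y i).
have mF i : measurable (F i) by apply: open_borel; exact: oW.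
have mE i : measurable (seqDU F i) by exact: seqDU_measurable.
exists (size (enum_fset D)), y, (seqDU F); split => //.
  by move=> i; exact: subset_seqDU.
rewrite -measure_bigsetU// -bigsetU_seqDU; apply: haar_supp.
  exact: bigsetU_measurable.
move=> x /HD[z /= zD Wzx]; rewrite -bigcup_mkord.
exists (index z (enum_fset D)) => /=; first by rewrite index_mem.
by rewrite /F /y nth_index.
Qed.

End Haar.

(** * Haar measures along a closed correspondence *)

Record closed_group_corr {T1 T2 : topologicalType} (o1 : group_ops T1)
    (o2 : group_ops T2) (H1 : set T1) (H2 : set T2) (rho : T1 -> T2 -> Prop) :
    Prop := ClosedCorr {
  corr_mul : forall x y x' y', rho x y -> rho x' y' ->
    rho (gmul o1 x x') (gmul o2 y y');
  corr_inv : forall x y, rho x y -> rho (ginv o1 x) (ginv o2 y);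
  corr_total : forall h, H1 h -> exists2 k, H2 k & rho h k;
  corr_onto : forall k, H2 k -> exists2 h, H1 h & rho h k;
  corr_closed_image : forall A, closed A -> closed (rel_image rho A);
  corr_closed_preimage : forall A, closed A -> closed (rel_preimage rho A) }.

Lemma closed_group_corr_eq {T : topologicalType} (o : group_ops T) (H : set T) :
  closed_group_corr o o H H eq.
Proof.
split=> [x _ x' _ <- <-|x _ <-|h Hh|h Hh|A|A] //; try by exists h.
  by rewrite rel_image_eq.
by rewrite rel_preimage_eq.
Qed.

Lemma closed_group_corr_sym {T1 T2 : topologicalType} (o1 : group_ops T1)
    (o2 : group_ops T2) (H1 : set T1) (H2 : set T2) (rho : T1 -> T2 -> Prop) :
  closed_group_corr o1 o2 H1 H2 rho ->
  closed_group_corr o2 o1 H2 H1 (fun y x => rho x y).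
Proof.
by case=> rhoM rhoV tot onto cl cl'; split=> //= [x y x' y'|x y];
  [exact: rhoM|exact: rhoV].
Qed.

Section Average.
Context {R : realType} {T1 T2 : ptopologicalType}.
Context {o1 : group_ops T1} {o2 : group_ops T2} {H1 : set T1} {H2 : set T2}.
Context {mu1 : {measure set (borelT T1) -> \bar R}}.
Context {mu2 : {measure set (borelT T2) -> \bar R}}.
Hypotheses (haar1 : haar_subgroup o1 H1 mu1) (haar2 : haar_subgroup o2 H2 mu2).
Context {rho : T1 -> T2 -> Prop} (corr : closed_group_corr o1 o2 H1 H2 rho).
Let cg1 := haar_compact_group haar1.
Let cg2 := haar_compact_group haar2.
Let grp1 : is_group o1. Proof. by case: cg1. Qed.
Local Open Scope ereal_scope.

Lemma translate_average_le (A : set T1) (U : set T2) :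
    closed (rel_image rho A) -> open U -> rel_image rho A `<=` U ->
  exists N (h : nat -> T1) (w : nat -> \bar R),
    [/\ forall i, H1 (h i), forall i, 0 <= w i, \sum_(i < N) w i = 1 &
        forall x, H1 x ->
          \sum_(i < N) w i * (\1_(gmul o1 (ginv o1 (h i)) @^-1` A) x)%:E <=
          mu2 (ginv o2 @^-1` U)].
Proof.
set S := rel_image rho A => clS oU SU.
pose W y0 := [set y | gmul o2 (ginv o2 y0) @^-1` S `<=`
  gmul o2 (ginv o2 y) @^-1` U]°.
have oW y0 : H2 y0 -> open (W y0) by move=> _; exact: open_interior.
have Wy0 y0 : H2 y0 -> W y0 y0 by move=> _; exact: (near_translate_subset cg2).
have [N [y [E [Hy mE tE EW sumE]]]] := haar_partition haar2 oW Wy0.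
have /choice[h hP] : forall i, exists h, H1 h /\ rho h (y i).
  by move=> i; have [h] := corr_onto corr (Hy i); exists h.
exists N, h, (mu2 \o E); split=> [i|//|//|x Hx].
  by case: (hP i).
have [k Hk rxk] := corr_total corr Hx.
(* If [(h i)^-1 x] is in [A] and [z] in [E i], then [z^-1 k] is in [U]; so the
   left-hand side is the measure of a disjoint union inside
   [{z | z^-1 k \in U}]. *)
pose B i := gmul o1 (ginv o1 (h i)) @^-1` A.
rewrite (eq_bigr (fun i : 'I_N => if x \in B i then mu2 (E i) else 0));
  last by move=> i _; rewrite indicE; case: ifP; rewrite ?mule1 ?mule0.
rewrite -big_mkcond /= -(measure_bigsetU_ord_cond mu2)//; last first.
  by move=> i j _ _ ?; apply/val_inj; exact: tE.
rewrite -(haar_preimage_ginv_translate haar2 Hk oU).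
apply: le_measure; rewrite ?inE.
- exact: bigsetU_measurable.
- apply: open_borel; move: U oU {SU W oW Wy0 EW}; apply/continuousP.
  apply: (continuous_gmul cg2); last by move=> ?; exact: cvg_cst.
  by apply: (continuous_ginv cg2) => ?; exact: cvg_id.
- rewrite -bigcup_seq_cond => z [i /= /andP[_ /set_mem Ahx]].
  move=> /EW /interior_subset; apply; exists (gmul o1 (ginv o1 (h i)) x) => //.
  by apply: (corr_mul corr) => //; apply: (corr_inv corr); case: (hP i).
Qed.

Lemma haar_le_preimage_ginv (A : set T1) (U : set T2) :
    closed A -> open U -> rel_image rho A `<=` U ->
  mu1 A <= mu2 (ginv o2 @^-1` U).
Proof.
move=> clA oU AU.
have [N [h [w [Hh w0 w1 avg]]]] :=
  translate_average_le (corr_closed_image corr clA) oU AU.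
pose B i : set (borelT T1) := gmul o1 (ginv o1 (h i)) @^-1` A.
have mB i : measurable (B i).
  by apply: closed_borel; exact: (closed_preimage_gmul cg1).
have mH1 := measurable_haar_subgroup haar1.
have muB i : mu1 (B i `&` H1) = mu1 A.
  rewrite (haar_setI haar1)//; apply: (haar_preimage_gmulV haar1 (Hh i)).
  exact: closed_borel.
have -> : mu1 A = \int[mu1]_(x in H1) \sum_(i < N) w i * (\1_(B i) x)%:E.
  rewrite integral_sum_indic//; under eq_bigr do rewrite muB.
  by rewrite -ge0_sume_distrl ?w1 ?mul1e.
set c := mu2 _; have -> : c = \int[mu1]_(x in H1) cst c x.
  by rewrite integral_cst// (haar_supp haar1) ?mule1.
apply: ge0_le_integral_nonmeas => x Hx; last exact: avg.
by apply: sume_ge0 => i _; apply: mule_ge0 => //; rewrite lee_fin.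
Qed.

Lemma haar_le_preimage_ginv_image (A : set T1) :
  closed A -> mu1 A <= mu2 (ginv o2 @^-1` rel_image rho A).
Proof.
move=> clA; have grp2 : is_group o2 by case: cg2.
set S := ginv o2 @^-1` _.
have clS : closed S.
  by apply: (closed_preimage_ginv cg2); exact: (corr_closed_image corr).
apply/lee_addgt0Pr => e e0.
have [V [oV SV muV]] := haar_outer haar2 (closed_borel clS) e0.
apply: le_trans (ltW muV); rewrite -(preimage_ginvK grp2 V).
apply: haar_le_preimage_ginv => //; first exact: (open_preimage_ginv cg2).
by move=> y Ay; apply: SV; rewrite /S /= (ginvK grp2).
Qed.

End Average.

Section Transfer.
Context {R : realType} {T1 T2 : ptopologicalType}.
Context {o1 : group_ops T1} {o2 : group_ops T2} {H1 : set T1} {H2 : set T2}.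
Context {mu1 : {measure set (borelT T1) -> \bar R}}.
Context {mu2 : {measure set (borelT T2) -> \bar R}}.
Hypotheses (haar1 : haar_subgroup o1 H1 mu1) (haar2 : haar_subgroup o2 H2 mu2).
Context {rho : T1 -> T2 -> Prop} (corr : closed_group_corr o1 o2 H1 H2 rho).
Local Open Scope ereal_scope.

Lemma haar_le_image (A : set T1) : closed A -> mu1 A <= mu2 (rel_image rho A).
Proof.
move=> clA.
apply: le_trans (haar_le_preimage_ginv_image haar1 haar2 corr clA) _.
have cg2 := haar_compact_group haar2.
have grp2 : is_group o2 by case: cg2.
have clS := closed_preimage_ginv cg2 (corr_closed_image corr clA).
have := haar_le_preimage_ginv_image haar2 haar2 (closed_group_corr_eq _ _) clS.
by rewrite rel_image_eq (preimage_ginvK grp2).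
Qed.

Lemma haar_inner_image (B : set (borelT T1)) (e : R) :
  measurable B -> (0 < e)%R -> exists K : set T1,
    [/\ closed K, K `<=` B & mu1 B <= mu2 (rel_image rho K) + e%:E].
Proof.
move=> mB e0; have [K [clK KB muK]] := haar_inner haar1 mB e0.
exists K; split=> //; apply: le_trans muK _; rewrite leeD2r//.
exact: haar_le_image.
Qed.

Lemma haar_le_corr (B1 : set (borelT T1)) (B2 : set (borelT T2)) :
  measurable B1 -> measurable B2 ->
  (forall x y, rho x y -> B1 x -> B2 y) -> mu1 B1 <= mu2 B2.
Proof.
move=> mB1 mB2 B12; apply/lee_addgt0Pr => e e0.
have [K [clK KB muK]] := haar_inner_image mB1 e0.
apply: le_trans muK _; rewrite leeD2r//; apply: le_measure; rewrite ?inE//.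
  by apply: closed_borel; exact: (corr_closed_image corr).
by move=> y [x /KB B1x rxy]; exact: B12 B1x.
Qed.

Lemma nnsfun_integral_le_corr (N : nat) (g : {nnsfun (borelT T1) >-> R})
    (phi2 : T2 -> \bar R) : (0 < N)%N -> (forall x, (g x <= 1)%R) ->
  (forall y, H2 y -> 0 <= phi2 y) ->
  (forall x y, (0 < g x)%R -> H2 y -> rho x y -> (g x)%:E <= phi2 y) ->
  \int[mu1]_x (g x)%:E <= \int[mu2]_(y in H2) phi2 y + (2 / N%:R)%:E.
Proof.
move=> N0 g1 phi0 gphi; pose e : R := (N%:R^-1)%R.
have e0 : (0 < e)%R by rewrite invr_gt0 ltr0n.
have Ne : (N%:R * e = 1)%R by rewrite mulfV// pnatr_eq0 -lt0n.
have e_ge0 : 0 <= e%:E by rewrite lee_fin ltW.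
pose B (i : nat) : set (borelT T1) := [set x | i.+1%:R * e <= g x]%R.
have mB i : measurable (B i).
  by rewrite -[B i]setTI; apply: measurable_fun_le.
have /choice[K KP] : forall i, exists K : set T1, [/\ closed K, K `<=` B i &
    mu1 (B i) <= mu2 (rel_image rho K) + e%:E].
  by move=> i; exact: haar_inner_image.
pose L i : set (borelT T2) := rel_image rho (K i).
have mL i : measurable (L i).
  by apply: closed_borel; apply: (corr_closed_image corr); case: (KP i).
have mH2 := measurable_haar_subgroup haar2.
have sumL : \sum_(i < N) e%:E * mu2 (L i) <= \int[mu2]_(y in H2) phi2 y.
  under eq_bigr do rewrite -(haar_setI haar2)//.
  apply: sum_levels_le_integral => // i y [x Kx rxy] Hy.
  have [_ /(_ _ Kx) Bx _] := KP i.
  apply: le_trans (gphi _ _ _ Hy rxy); first by rewrite lee_fin.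
  by apply: lt_le_trans Bx; rewrite mulr_gt0.
have sumB : \sum_(i < N) e%:E * mu1 (B i) <=
    \sum_(i < N) e%:E * mu2 (L i) + e%:E.
  apply: (@le_trans _ _ (\sum_(i < N) (e%:E * mu2 (L i) + (e * e)%:E))).
    apply: lee_sum => i _; rewrite EFinM -muleDr ?fin_num_adde_defl//.
    by rewrite lee_wpmul2l//; case: (KP i).
  rewrite big_split /= leeD2l// sumEFin lee_fin sumr_const card_ord.
  by rewrite -mulr_natl mulrA Ne mul1r.
apply: le_trans (integral_le_sum_levels (N := N) (e := e) mu1 _ _ e0 _) _ => //.
  by move=> x _; rewrite fun_ge0 Ne g1.
under eq_bigr do rewrite setIT.
apply: (@le_trans _ _ (e%:E + (\int[mu2]_(y in H2) phi2 y + e%:E))).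
  apply: leeD; first by rewrite -[leRHS]mule1 lee_wpmul2l// (haar_le1 haar1).
  by apply: le_trans sumB _; rewrite leeD2r.
by rewrite addeCA leeD// -EFinD lee_fin /e; lra.
Qed.

Lemma haar_integral_le_corr (phi1 : T1 -> \bar R) (phi2 : T2 -> \bar R) :
    (forall x, H1 x -> 0 <= phi1 x <= 1) -> (forall y, H2 y -> 0 <= phi2 y) ->
    (forall x y, H1 x -> H2 y -> rho x y -> phi1 x <= phi2 y) ->
  \int[mu1]_(x in H1) phi1 x <= \int[mu2]_(y in H2) phi2 y.
Proof.
move=> phi1_01 phi2_ge0 phi12.
rewrite (ge0_integralE mu1); last by move=> x /phi1_01/andP[].
apply: ge_ereal_sup => _ [g gphi <-]; rewrite -integralT_nnsfun.
have gH1 x : (0 < g x)%R -> H1 x /\ (g x)%:E <= phi1 x.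
  move=> gx0; have := gphi x; rewrite /patch; case: ifPn => [/set_mem//|_].
  by rewrite lee_fin leNgt gx0.
apply/lee_addgt0Pr => e e0; set N := (Num.truncn (2 / e)).+1.
apply: (@le_trans _ _ (\int[mu2]_(y in H2) phi2 y + (2 / N%:R)%:E)).
  apply: nnsfun_integral_le_corr => // [x|x y /gH1[Hx gx] Hy rxy].
    rewrite leNgt; apply/negP => g1; have [Hx gx] := gH1 x (lt_trans ltr01 g1).
    have /andP[_ /(le_trans gx)] := phi1_01 x Hx.
    by rewrite lee_fin leNgt g1.
  exact/(le_trans gx)/phi12.
rewrite leeD2l// lee_fin ler_pdivrMr// mulrC -ler_pdivrMr//.
exact/ltW/truncnS_gt.
Qed.

End Transfer.

Section Invariance.
Context {R : realType} {T1 T2 : ptopologicalType}.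
Context {o1 : group_ops T1} {o2 : group_ops T2} {H1 : set T1} {H2 : set T2}.
Context {mu1 : {measure set (borelT T1) -> \bar R}}.
Context {mu2 : {measure set (borelT T2) -> \bar R}}.
Hypotheses (haar1 : haar_subgroup o1 H1 mu1) (haar2 : haar_subgroup o2 H2 mu2).
Context {rho : T1 -> T2 -> Prop} (corr : closed_group_corr o1 o2 H1 H2 rho).
Local Open Scope ereal_scope.

Lemma haar_corr_eq (B1 : set (borelT T1)) (B2 : set (borelT T2)) :
  measurable B1 -> measurable B2 ->
  (forall x y, rho x y -> B1 x <-> B2 y) -> mu1 B1 = mu2 B2.
Proof.
move=> mB1 mB2 B12; apply/eqP; rewrite eq_le; apply/andP; split.
  by apply: (haar_le_corr haar1 haar2 corr) => // x y /B12[].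
apply: (haar_le_corr haar2 haar1 (closed_group_corr_sym corr)) => // y x.
by case/B12.
Qed.

Lemma haar_integral_corr_eq (phi1 : T1 -> \bar R) (phi2 : T2 -> \bar R) :
    (forall x, H1 x -> 0 <= phi1 x <= 1) ->
    (forall y, H2 y -> 0 <= phi2 y <= 1) ->
    (forall x y, H1 x -> H2 y -> rho x y -> phi1 x = phi2 y) ->
  \int[mu1]_(x in H1) phi1 x = \int[mu2]_(y in H2) phi2 y.
Proof.
move=> phi1_01 phi2_01 phi12; apply/eqP; rewrite eq_le; apply/andP; split.
  apply: (haar_integral_le_corr haar1 haar2 corr) => // [y /phi2_01/andP[]|] //.
  by move=> x y Hx Hy rxy; rewrite (phi12 x y).
apply: (haar_integral_le_corr haar2 haar1 (closed_group_corr_sym corr)) => //.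
  by move=> x /phi1_01/andP[].
by move=> y x Hy Hx rxy; rewrite (phi12 x y).
Qed.

Lemma iint_corr_eq (k : nat) (F1 : seq T1 -> \bar R) (F2 : seq T2 -> \bar R) :
  (forall s, 0 <= F1 s <= 1) -> (forall s, 0 <= F2 s <= 1) ->
  (forall hs ks, size hs = k -> size ks = k -> all_in H1 hs -> all_in H2 ks ->
    (forall i, (i < k)%N -> rho (nth (gone o1) hs i) (nth (gone o2) ks i)) ->
    F1 hs = F2 ks) ->
  iint H1 mu1 k F1 = iint H2 mu2 k F2.
Proof.
have mH1 := measurable_haar_subgroup haar1.
have mH2 := measurable_haar_subgroup haar2.
elim: k F1 F2 => [|k IHk] F1 F2 F1_01 F2_01 F12 /=; first exact: F12.
apply: haar_integral_corr_eq => [x _|y _|x y Hx Hy rxy].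
- by apply: iint_ge0_le1 => //; exact: (haar_le1 haar1).
- by apply: iint_ge0_le1 => //; exact: (haar_le1 haar2).
apply: IHk => // hs ks shs sks Hhs Hks rhk.
by apply: F12 => /=; rewrite ?shs ?sks// => -[|i] //=; exact: rhk.
Qed.

End Invariance.

(** * Isoclinism *)

Section QuotientIsomorphism.
Context {T1 T2 : ptopologicalType} {o1 : group_ops T1} {o2 : group_ops T2}.
Context {N1 : set T1} {N2 : set T2} {alpha : T1 -> T2}.
Hypotheses (cg1 : compact_group o1) (cg2 : compact_group o2).
Hypothesis nN1 : normal_subgroup o1 N1.
Hypothesis nN2 : normal_subgroup o2 N2.
Hypotheses (clN1 : closed N1) (clN2 : closed N2).
Hypothesis alphaE : forall x y,
  cong_mod o1 N1 x y <-> cong_mod o2 N2 (alpha x) (alpha y).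
Hypothesis alpha_onto : forall y, exists x, cong_mod o2 N2 (alpha x) y.
Hypothesis alphaM : forall x y, cong_mod o2 N2 (alpha (gmul o1 x y))
  (gmul o2 (alpha x) (alpha y)).
Let grp1 : is_group o1. Proof. by case: cg1. Qed.
Let grp2 : is_group o2. Proof. by case: cg2. Qed.
Let rho x y := cong_mod o2 N2 (alpha x) y.

Lemma quotient_iso_mul x y x' y' :
  rho x y -> rho x' y' -> rho (gmul o1 x x') (gmul o2 y y').
Proof.
move=> rxy rxy'; apply: (cong_mod_trans grp2 nN2) (alphaM _ _) _.
exact: (cong_modM grp2 nN2).
Qed.

Lemma quotient_iso_inv x y : rho x y -> rho (ginv o1 x) (ginv o2 y).
Proof.
move=> rxy; apply: (cong_mod_trans grp2 nN2) _ (cong_modV grp2 nN2 rxy).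
have alpha1 : cong_mod o2 N2 (alpha (gone o1)) (gone o2).
  have := alphaM (gone o1) (gone o1); rewrite (gmulg1 grp1) /cong_mod.
  rewrite (gmulKg grp2) (gmulg1 grp2); case: nN2 => -[_ _ NV] _; exact: NV.
have := cong_mod_trans grp2 nN2 (cong_mod_sym grp2 nN2 (alphaM (ginv o1 x) x)).
rewrite (gmulVg grp1) => /(_ _ alpha1).
move/(cong_modM grp2 nN2)/(_ (cong_mod_refl grp2 nN2 (ginv o2 (alpha x)))).
by rewrite !(gsimp grp2).
Qed.

Lemma quotient_iso_closed_image :
  (forall U : set T1, open U -> saturated o1 N1 U -> open (rel_image rho U)) ->
  forall A, closed A -> closed (rel_image rho A).
Proof.
move=> alpha_open A clA; rewrite -[rel_image rho A]setCK; apply: open_closedC.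
pose AN := rel_image (cong_mod o1 N1) A.
have -> : ~` rel_image rho A = rel_image rho (~` AN).
  apply/seteqP; split=> y /= nA.
    have [x rxy] := alpha_onto y; exists x => // -[a Aa /alphaE ax].
    by apply: nA; exists a => //; exact: (cong_mod_trans grp2 nN2) ax rxy.
  move=> [a Aa ray]; case: nA => x nAx rxy; apply: nAx; exists a => //.
  apply/alphaE; apply: (cong_mod_trans grp2 nN2) ray _.
  exact: (cong_mod_sym grp2 nN2).
apply: alpha_open; first exact/closed_openC/(closed_cong_mod cg1).
exact: (saturatedC_cong_mod grp1 nN1).
Qed.

Lemma quotient_iso_closed_preimage :
  (forall V : set T2, open V -> saturated o2 N2 V -> open (alpha @^-1` V)) ->
  forall A, closed A -> closed (rel_preimage rho A).
Proof.
move=> alpha_cont A clA.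
have -> : rel_preimage rho A = ~` (alpha @^-1` ~` rel_image (cong_mod o2 N2) A).
  rewrite preimage_setC setCK; apply/seteqP.
  by split=> x [a Aa ax]; exists a => //; exact: (cong_mod_sym grp2 nN2).
apply: open_closedC; apply: alpha_cont.
  exact/closed_openC/(closed_cong_mod cg2).
exact: (saturatedC_cong_mod grp2 nN2).
Qed.

End QuotientIsomorphism.

Lemma rel_n_isoclinic_corr (n : nat) (T1 T2 : ptopologicalType)
    (o1 : group_ops T1) (o2 : group_ops T2) (H1 : set T1) (H2 : set T2) :
  compact_group o1 -> compact_group o2 -> rel_n_isoclinic n o1 H1 o2 H2 ->
  exists rho : T1 -> T2 -> Prop,
    [/\ closed_group_corr o1 o2 H1 H2 rho,
        closed_group_corr o1 o2 setT setT rho &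
        forall hs ks g g', size hs = n -> size ks = n ->
          all_in H1 hs -> all_in H2 ks ->
          (forall i, (i < n)%N ->
            rho (nth (gone o1) hs i) (nth (gone o2) ks i)) -> rho g g' ->
          commn o1 hs g = gone o1 <-> commn o2 ks g' = gone o2].
Proof.
move=> cg1 cg2 [alpha [beta [beta' [[alphaE alpha_onto alphaM] [tot onto]
  [alpha_cont alpha_open] [[_ _ betaK _ betaM] _] beta_comm]]]].
have [grp1 grp2] : is_group o1 /\ is_group o2 by case: cg1; case: cg2.
have nZ1 := upper_central_normal grp1 n.
have nZ2 := upper_central_normal grp2 n.
have clZ1 := closed_upper_central cg1 (n := n).
have clZ2 := closed_upper_central cg2 (n := n).
pose rho x y := cong_mod o2 (upper_central o2 n) (alpha x) y.
have rhoM := quotient_iso_mul cg2 nZ2 alphaM.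
have rhoV := quotient_iso_inv cg1 cg2 nZ2 alphaM.
have cl_rho := quotient_iso_closed_image cg1 cg2 nZ1 nZ2 clZ1 alphaE alpha_onto
  alpha_open.
have cl_rho' := quotient_iso_closed_preimage cg2 nZ2 clZ2 alpha_cont.
exists rho; split=> // [|hs ks g g' shs sks Hhs Hks hk gg'].
  split=> // [x _|y _]; last by have [x] := alpha_onto y; exists x.
  by exists (alpha x) => //; exact: (cong_mod_refl grp2).
rewrite -(beta_comm hs g ks g')//; apply: iff_sym.
apply: (cancel_morph_eq1 grp1 grp2 _ betaK betaM) => [K []//|K _].
by apply; exists hs, g.
Qed.

Theorem theorem1p1 (R : realType) (n : nat) (T1 T2 : ptopologicalType)
    (o1 : group_ops T1) (o2 : group_ops T2) (H1 : set T1) (H2 : set T2)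
    (muH1 muG1 : {measure set (borelT T1) -> \bar R})
    (muH2 muG2 : {measure set (borelT T2) -> \bar R}) :
  (1 <= n)%N ->
  compact_group o1 -> compact_group o2 ->
  is_subgroup o1 H1 -> closed H1 -> is_subgroup o2 H2 -> closed H2 ->
  haar_on o1 H1 muH1 -> haar_on o1 [set: T1] muG1 ->
  haar_on o2 H2 muH2 -> haar_on o2 [set: T2] muG2 ->
  rel_n_isoclinic n o1 H1 o2 H2 ->
  rel_nilp_degree o1 n H1 muH1 muG1 = rel_nilp_degree o2 n H2 muH2 muG2.
Proof.
move=> _ cg1 cg2 sg1 cl1 sg2 cl2 haarH1 haarG1 haarH2 haarG2.
move=> /(rel_n_isoclinic_corr cg1 cg2)[rho [corrH corrG commn_eq1]].
have haar1 : haar_subgroup o1 H1 muH1 by [].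
have haar2 : haar_subgroup o2 H2 muH2 by [].
have haarT1 : haar_subgroup o1 setT muG1 by split=> //; exact: closedT.
have haarT2 : haar_subgroup o2 setT muG2 by split=> //; exact: closedT.
have mE1 hs := closed_borel (closed_commn_eq1 cg1 (hs := hs)).
have mE2 ks := closed_borel (closed_commn_eq1 cg2 (hs := ks)).
apply: (iint_corr_eq haar1 haar2 corrH) => [hs|ks|hs ks shs sks Hhs Hks hk].
- by rewrite measure_ge0 (haar_le1 haarT1).
- by rewrite measure_ge0 (haar_le1 haarT2).
- by apply: (haar_corr_eq haarT1 haarT2 corrG) => // g g'; exact: commn_eq1.
Qed.
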